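(* Let $x\in(0,1)$ and $X_0=x$. (a) If $\sum_n\gamma_n^2e^{\pi\Gamma_n}<+\infty$, then the martingale $(Y_n)_{n\in\mathbb{N}}$ is bounded in $L^2$ and its limit satisfies $\mathbb{E}(X_\infty Y_\infty)>0$. Moreover, almost surely on the set $\{Y_\infty=0\}$, $$\limsup_{n\to\infty}\frac{Y_n}{\sum_{k\ge n}\gamma_{k+1}^2e^{\pi\Gamma_{k+1}}}<+\infty .$$ (b) If $$\sum_n\gamma_n^2e^{\pi\Gamma_n}=+\infty\quad\text{and}\quad\sup_{n\ge1}\gamma_ne^{\pi\Gamma_n}<+\infty,$$ then, for every $x\in(0,1)$, $$\{X_\infty=1\}=\{Y_\infty=0\}\quad\mathbb{P}_x\text{-a.s. (i.e. up to a $\mathbb{P}_x$-null set).}$$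
   Context: Let $0<p_B<p_A<1$ and $\pi=p_A-p_B>0$. Let $(\gamma_n)_{n\ge1}$ be a deterministic sequence in $(0,1)$ with $\Gamma_n=\sum_{k=1}^n\gamma_k\to+\infty$. Let $(U_n)_{n\ge1}$ be i.i.d. uniform random variables on $[0,1]$, and let $(A_n)_{n\ge1}$, $(B_n)_{n\ge1}$ be events with $\mathbb{P}(A_n)=p_A$, $\mathbb{P}(B_n)=p_B$ for all $n$; the pairs $(\mathbf 1_{A_n},\mathbf 1_{B_n})_{n\ge1}$ are independent in $n$ (no assumption is made on the dependence between $A_n$ and $B_n$), and the sequence $(\mathbf 1_{A_n},\mathbf 1_{B_n})_{n\ge1}$ is independent of $(U_n)_{n\ge1}$. The two-armed bandit algorithm is defined by $X_0=x$ and $$X_{n+1}=X_n+\gamma_{n+1}\left(\mathbf 1_{\{U_{n+1}\le X_n\}\cap A_{n+1}}(1-X_n)-\mathbf 1_{\{U_{n+1}>X_n\}\cap B_{n+1}}X_n\right),\quad n\ge0.$$ The notation $\mathbb{P}_x$ refers to $X_0=x$. The sequence $(X_n)$ takes values in $[0,1]$ and converges a.s. to a random variable $X_\infty$ with values in $\{0,1\}$ a.s. Let $\mathcal F_n$ be the $\sigma$-field generated by $(U_k,\mathbf 1_{A_k},\mathbf 1_{B_k})_{1\le k\le n}$. Set $$\theta_n=\prod_{k=1}^n(1-\gamma_k\pi X_{k-1}),\qquad Y_n=\frac{1-X_n}{\theta_n},\quad n\in\mathbb{N}$$ (with $\theta_0=1$). The sequence $(Y_n)$ is a non-negative $(\mathcal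 F_n)$-martingale, and $Y_\infty=\lim_{n\to\infty}Y_n$ denotes its a.s. limit. *)

(* Defs.v *)
From HB Require Import structures.
From mathcomp Require Import all_boot all_order all_algebra.
From mathcomp Require Import all_classical all_reals all_analysis.
Set Implicit Arguments.
Unset Strict Implicit.
Unset Printing Implicit Defensive.
Import Order.TTheory GRing.Theory Num.Theory.
Import numFieldNormedType.Exports.
Local Open Scope classical_set_scope.
Local Open Scope ring_scope.

Definition sigma_rv (d d' : measure_display) (T : measurableType d)
    (T' : measurableType d') (f : T -> T') : set_system T :=
  preimage_set_system [set: T] f measurable.

Definition sigma_family (T I : Type) (D : set I) (F : I -> set_system T) :
    set_system T :=
  <<s \bigcup_(i in D) F i >>.

(* [J] enumerates a finite subset of the index set [D]. *)
Definition mutually_independent (d : measure_display) (T : measurableType d)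
    (R : realType) (P : probability T R) (I : eqType) (D : set I)
    (F : I -> set_system T) : Prop :=
  forall (J : seq I) (E : I -> set T),
    uniq J -> (forall i, i \in J -> D i /\ F i (E i)) ->
    P (\bigcap_(i in [set` J]) E i) = (\prod_(i <- J) P (E i))%E.

Definition independent_systems (d : measure_display) (T : measurableType d)
    (R : realType) (P : probability T R) (F G : set_system T) : Prop :=
  forall E E' : set T, F E -> G E' -> P (E `&` E') = (P E * P E')%E.

(* All the sequences indexed by n >= 1 are functions on nat whose value at 0
   is irrelevant. *)
Definition ge1 : set nat := [set n | (1 <= n)%N].

Definition indic_pair (T : Type) (R : realType) (A B : set T) (w : T) : R * R :=
  (\1_A w, \1_B w).

Definition Gam (R : realType) (gamma : nat -> R) (n : nat) : R :=
  \sum_(1 <= k < n.+1) gamma k.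

Fixpoint bandit (T : Type) (R : realType) (gamma : nat -> R) (U : nat -> T -> R)
    (A B : nat -> set T) (x : R) (n : nat) (w : T) {struct n} : R :=
  if n is m.+1 then
    let X := bandit gamma U A B x m in
    X w + gamma m.+1 *
      (\1_([set v | U m.+1 v <= X v] `&` A m.+1) w * (1 - X w)
       - \1_([set v | U m.+1 v > X v] `&` B m.+1) w * X w)
  else x.

(* [p] stands for the gap pA - pB. *)
Definition theta (T : Type) (R : realType) (p : R) (gamma : nat -> R)
    (X : nat -> T -> R) (n : nat) (w : T) : R :=
  \prod_(1 <= k < n.+1) (1 - gamma k * p * X k.-1 w).

Definition Ymart (T : Type) (R : realType) (p : R) (gamma : nat -> R)
    (X : nat -> T -> R) (n : nat) (w : T) : R :=
  (1 - X n w) / theta p gamma X n w.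

(* Main.v *)
Require Import Defs.
From HB Require Import structures.
From mathcomp Require Import all_boot all_order all_algebra.
From mathcomp Require Import all_classical all_reals all_analysis.
From mathcomp Require Import measurable_realfun ring lra.
Set Implicit Arguments.
Unset Strict Implicit.
Unset Printing Implicit Defensive.
Import Order.TTheory GRing.Theory Num.Theory.
Import numFieldNormedType.Exports.
Local Open Scope classical_set_scope.
Local Open Scope ring_scope.

(** At each step only four things can happen: U_(n+1) <= X_n or not, and the
    arm that is then played (A or B) wins or loses.  So X_n, theta_n and Y_n are
    functions of a word of length n over a four-letter alphabet, its history, and
    by the independence assumptions the next letter has, given
    the history, the product weights of [step_mean].  Hence expectations of
    functions of the first n steps are finite sums ([integral_history]), and
    every conditional expectation below is the elementary average [step_mean].

    Write p = pA - pB, a_n = gamma_n^2 exp (p Gamma_n), and assume that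
    sum gamma_n^2 is finite, which both (a) and (b) imply.  Then 1 / theta_n is at
    most a constant times exp (p Gamma_n) ([inv_theta_le_expR]), and the
    conditional variance of Y_(n+1) is at most C a_(n+1) Y_n
    ([step_mean_sqr_le]).

    (a) Summing this bound, with E Y_n = 1 - x, bounds E Y_n^2.  One step
    multiplies the mean of X Y by at least 1 - k gamma^2 with k < 1
    ([step_mean_XY]), so E (X_n Y_n) stays above some c > 0.  If the limit of
    X_n Y_n vanished almost surely, Fatou's lemma for the nonnegative
    (X_n Y_n - b)^2 would give b^2 <= M - 2 b c + b^2 for all b, which fails for
    b = M / c.  For the last claim let rho_n be the tail of the series and
    stop when Y first exceeds K rho, at the value v.  After that time
    (Y_n / v - 1)^2 + C rho_n Y_n / v^2 is a supermartingale which starts at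
    most at C / K ([step_mean_passage_potential]); on the event that Y
    tends to 0 its first term tends to 1.  So the event that Y tends to 0 and
    exceeds K rho at least once has probability at most C / K, and K is free.

    (b) If Y tends to 0 then X tends to 1 because theta <= 1.  For the converse,
    the increments of Y are bounded by some c, so the strictly convex bounded
    function 1 / (1 + Y) has a mean that grows at each step by a definite amount,
    [inverse_gain], comparable to a_(n+1) as long as X is near 1 and Y is near a
    positive limit.  As 1 / (1 + Y) <= 1, the gains have a finite sum almost
    surely, which contradicts the divergence of sum a_n.  The comparison needs
    1 / theta_n to be of the exact order exp (p Gamma_n) along such a
    trajectory; this is [inverse_gain_critical_term]. *)

(** * Real series, lower and upper limits *)

Lemma invr_1B_le_expR (R : realType) (u v : R) : 0 <= u -> u <= v -> v < 1 ->
  (1 - u)^-1 <= expR (u + u ^+ 2 / (1 - v)).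
Proof.
move=> u0 uv v1; apply: le_trans (expR_ge1Dx _).
have -> : (1 - u)^-1 = 1 + (u + u ^+ 2 / (1 - u)).
  by field; rewrite subr_eq0 eq_sym lt_eqF//; lra.
by rewrite !lerD2l ler_wpM2l ?sqr_ge0// lef_pV2 ?posrE; lra.
Qed.

Lemma nneseries_shift1 (R : realType) (a : nat -> R) : (forall n, 0 <= a n) ->
  (\sum_(0 <= k <oo) (a k.+1)%:E = \sum_(1 <= k <oo) (a k)%:E)%E.
Proof.
move=> a0; rewrite -(nneseries_addn (f := fun k => (a k)%:E) 1) => [|i].
  by apply: eq_eseriesr => i _; rewrite addn1.
by rewrite lee_fin.
Qed.

Section RealSeries.
Variables (R : realType) (a : nat -> R).
Hypothesis a0 : forall n, 0 <= a n.
Hypothesis sumfin : (\sum_(1 <= n <oo) (a n)%:E < +oo)%E.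

Let e1 N : forall k : nat, (N <= k)%N -> (0 <= (a k.+1)%:E)%E.
Proof. by move=> *; rewrite lee_fin. Qed.

Lemma partial_sum_le_fine n :
  \sum_(1 <= k < n.+1) a k <= fine (\sum_(1 <= n <oo) (a n)%:E)%E.
Proof.
rewrite -lee_fin -sumEFin fineK; first by apply: nneseries_lim_ge => *; rewrite lee_fin.
by rewrite ge0_fin_numE// nneseries_ge0// => *; rewrite lee_fin.
Qed.

Definition tail_sum n : R := fine (\sum_(n <= k <oo) (a k.+1)%:E)%E.

Lemma tail_sum_fin n : (\sum_(n <= k <oo) (a k.+1)%:E)%E \is a fin_num.
Proof.
rewrite ge0_fin_numE ?nneseries_ge0//; last by move=> k nk _; exact: e1 nk.
apply: le_lt_trans sumfin; rewrite -nneseries_shift1// (nneseries_split 0 n); last exact: e1.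
by rewrite add0n leeDr// sume_ge0// => k _; rewrite lee_fin.
Qed.

Lemma tail_sumS n : tail_sum n = a n.+1 + tail_sum n.+1.
Proof.
rewrite /tail_sum (nneseries_split n 1); last exact: e1.
rewrite addn1 big_nat1 fineD ?tail_sum_fin//.
Qed.

Lemma tail_sum_ge0 n : 0 <= tail_sum n.
Proof. by apply: fine_ge0; apply: nneseries_ge0 => k _ _; rewrite lee_fin. Qed.

End RealSeries.

Lemma nneseries_unbounded (R : realType) (a : nat -> R) (N : nat) (S : R) :
  (forall n, 0 <= a n) -> (\sum_(1 <= n <oo) (a n)%:E = +oo)%E ->
  ~ (forall n, \sum_(N <= k < n) a k.+1 <= S).
Proof.
move=> a0 ainf hS.
have e1 : forall k : nat, (0 <= (a k.+1)%:E)%E by move=> *; rewrite lee_fin.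
have hN : (\sum_(N <= k <oo) (a k.+1)%:E <= S%:E)%E.
  apply: lime_le; first by apply: is_cvg_nneseries => *; apply: e1.
  by apply: nearW => n; rewrite sumEFin lee_fin hS.
move: ainf; rewrite -nneseries_shift1// (nneseries_split 0 N)// add0n sumEFin.
move=> h; have : (S%:E + (\sum_(0 <= k < N) a k.+1)%:E < +oo)%E by rewrite -EFinD ltry.
rewrite addeC => /(le_lt_trans (leeD (lexx _) hN)).
by rewrite h.
Qed.

Lemma limn_einf_le (R : realType) (u : nat -> \bar R) (c : \bar R) :
  (forall n, u n <= c)%E -> (limn_einf u <= c)%E.
Proof.
move=> uc; rewrite limn_einf_lim; apply: lime_le; first exact: is_cvg_einfs.
apply: nearW => n; apply: le_trans (uc n); apply: ereal_inf_lbound.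
by exists n => /=.
Qed.

Lemma limn_einf_ge0 (R : realType) (u : nat -> \bar R) :
  (forall n, 0 <= u n)%E -> (0 <= limn_einf u)%E.
Proof.
move=> u0; rewrite limn_einf_lim; apply: lime_ge; first exact: is_cvg_einfs.
by apply: nearW => n; apply: le_ereal_inf_tmp => _ [k _ <-].
Qed.

Lemma limn_esup_le (R : realType) (u : nat -> \bar R) (c : \bar R) :
  (forall n, u n <= c)%E -> (limn_esup u <= c)%E.
Proof.
move=> uc; rewrite limn_esup_lim; apply: lime_le; first exact: is_cvg_esups.
by apply: nearW => n; apply: ge_ereal_sup => _ [k _ <-].
Qed.

Lemma limn_einf_cvg (R : realType) (u : nat -> R) (l : R) :
  u n @[n --> \oo] --> l -> limn_einf (fun n => (u n)%:E) = l%:E.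
Proof.
move=> ul; have [] := @cvg_limn_einf_sup R (fun n => (u n)%:E) l%:E; last by [].
by apply/fine_cvgP; split=> //; apply: nearW.
Qed.

(** * The tree of histories *)

(** The first component of a letter is the truth value of U_(n+1) <= X_n, the
    second tells whether the arm chosen accordingly wins.  Histories are words with
    the latest letter first. *)
Definition letter := (bool * bool)%type.

Record bandit_parameters (R : realType) (pA pB : R) (gamma : nat -> R) (x : R) :
    Prop := BanditParameters {
  pB_gt0 : 0 < pB;
  pB_lt_pA : pB < pA;
  pA_lt1 : pA < 1;
  gain01 : forall n, (1 <= n)%N -> 0 < gamma n < 1;
  start01 : 0 < x < 1
}.

Section HistoryTree.
Variables (R : realType) (pA pB : R) (gamma : nat -> R) (x : R).
Hypothesis par : bandit_parameters pA pB gamma x.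

Notation p := (pA - pB).
Notation gam s := (gamma (size s).+1).

Fixpoint arm_state (s : seq letter) : R :=
  if s is (u, a) :: s' then
    arm_state s' + gam s' * ((u && a)%:R * (1 - arm_state s')
                             - (~~ u && a)%:R * arm_state s')
  else x.

Fixpoint hist_theta (s : seq letter) : R :=
  if s is _ :: s' then hist_theta s' * (1 - gam s' * p * arm_state s') else 1.

Definition hist_Y (s : seq letter) : R := (1 - arm_state s) / hist_theta s.

(** The conditional expectation of [f] given the history [s]. *)
Definition step_mean (f : seq letter -> R) (s : seq letter) : R :=
  arm_state s * (pA * f ((true, true) :: s) + (1 - pA) * f ((true, false) :: s))
  + (1 - arm_state s) *
    (pB * f ((false, true) :: s) + (1 - pB) * f ((false, false) :: s)).

(** The expectation of [f] over the first [n] steps, by the tower property. *)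
Fixpoint hist_mean (n : nat) (f : seq letter -> R) : R :=
  if n is m.+1 then hist_mean m (step_mean f) else f [::].

Lemma gam01 n : 0 < gamma n.+1 < 1. Proof. exact: (gain01 par). Qed.

Lemma arm_probs : [/\ 0 < pB, pB < 1, 0 < pA, pA < 1 & pB < pA].
Proof. by have [? ? ? _ _] := par; split=> //; lra. Qed.

Lemma gap01 : 0 < p < 1.
Proof. by have [*] := arm_probs; apply/andP; split; lra. Qed.

Lemma arm_state01 s : 0 < arm_state s < 1.
Proof.
elim: s => [|[u a] s /andP[X0 X1]] /=; first exact: start01 par.
have /andP[g0 g1] := gam01 (size s).
have gX := mulr_gt0 g0 X0.
have X1' : 0 < 1 - arm_state s by lra.
have gX' := mulr_gt0 g0 X1'.
have g1' : 0 < 1 - gam s by lra.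
have hX := mulr_gt0 g1' X0; have hX' := mulr_gt0 g1' X1'.
by case: u; case: a => /=; apply/andP; split; nra.
Qed.

Lemma hist_rate_bounds s :
  1 - p <= 1 - gam s * p * arm_state s <= 1.
Proof.
have /andP[X0 X1] := arm_state01 s.
have /andP[g0 g1] := gam01 (size s).
have /andP[p0 p1] := gap01.
have gX0 : 0 <= gam s * arm_state s by rewrite mulr_ge0// ltW.
have gX1 : gam s * arm_state s <= 1.
  by rewrite -[leRHS](mulr1 1) ler_pM// ltW.
by apply/andP; split; nra.
Qed.

Lemma hist_rate_gt0 s : 0 < 1 - gam s * p * arm_state s.
Proof.
by have /andP[h _] := hist_rate_bounds s; apply: lt_le_trans h;
  have /andP[_ p1] := gap01; lra.
Qed.

Lemma hist_theta_gt0 s : 0 < hist_theta s.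
Proof. by elim: s => //= a s IH; rewrite mulr_gt0// hist_rate_gt0. Qed.

Lemma hist_theta_le1 s : hist_theta s <= 1.
Proof.
elim: s => //= a s IH.
have /andP[_ h] := hist_rate_bounds s.
by rewrite -[leRHS](mulr1 1) ler_pM// ltW ?hist_theta_gt0// hist_rate_gt0.
Qed.

Lemma hist_Y_gt0 s : 0 < hist_Y s.
Proof.
have /andP[X0 X1] := arm_state01 s.
by rewrite /hist_Y divr_gt0 ?hist_theta_gt0//; lra.
Qed.

Lemma hist_theta_cons l s :
  hist_theta (l :: s) = hist_theta s * (1 - gam s * p * arm_state s).
Proof. by []. Qed.

Lemma step_mean_le f g s : (forall l, f (l :: s) <= g (l :: s)) ->
  step_mean f s <= step_mean g s.
Proof.
move=> fg; have /andP[X0 X1] := arm_state01 s; have [*] := arm_probs.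
rewrite /step_mean lerD// ler_wpM2l//; [lra| |lra|];
  by rewrite lerD// ler_wpM2l//; lra.
Qed.

Lemma step_mean_cst c s : step_mean (cst c) s = c.
Proof. rewrite /step_mean /cst /=; ring. Qed.

Lemma step_mean_lin (a b : R) f g s :
  step_mean (fun t => a * f t + b * g t) s = a * step_mean f s + b * step_mean g s.
Proof. rewrite /step_mean; ring. Qed.

Lemma hist_mean_le n f g : (forall s, size s = n -> f s <= g s) ->
  hist_mean n f <= hist_mean n g.
Proof.
elim: n f g => [|n IH] f g fg /=; first exact: fg.
by apply: IH => s sn; apply: step_mean_le => l; apply: fg; rewrite /= sn.
Qed.

Lemma hist_mean_eq n f g : (forall s, size s = n -> f s = g s) ->
  hist_mean n f = hist_mean n g.
Proof.
by move=> fg; apply/eqP; rewrite eq_le !hist_mean_le// => s /fg ->.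
Qed.

Lemma hist_mean_lin n (a b : R) f g :
  hist_mean n (fun t => a * f t + b * g t) = a * hist_mean n f + b * hist_mean n g.
Proof.
elim: n f g => [//|n IH] f g /=.
by rewrite -IH; apply: hist_mean_eq => s _; rewrite step_mean_lin.
Qed.

Lemma hist_mean_cst n c : hist_mean n (cst c) = c.
Proof.
elim: n => [//|n IH] /=.
by rewrite -[RHS]IH; apply: hist_mean_eq => s _; rewrite step_mean_cst.
Qed.

Lemma hist_mean_supermartingale n (f : seq letter -> R) c :
  (forall s, step_mean f s <= f s) -> f [::] <= c -> hist_mean n f <= c.
Proof.
move=> hf f0; elim: n => [//|n IH] /=.
by apply: le_trans IH; apply: hist_mean_le => s _; apply: hf.
Qed.

Lemma step_mean_Y s : step_mean hist_Y s = hist_Y s.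
Proof.
have t0 := lt0r_neq0 (hist_theta_gt0 s).
have r0 := lt0r_neq0 (hist_rate_gt0 s).
rewrite /step_mean /hist_Y /=.
by field; rewrite r0 t0.
Qed.

Lemma hist_mean_Y n : hist_mean n hist_Y = 1 - x.
Proof.
elim: n => [|n IH] /=; first by rewrite /hist_Y /= divr1.
by rewrite -[RHS]IH; apply: hist_mean_eq => s _; rewrite step_mean_Y.
Qed.

(** The conditional variance of the next X is gamma^2 (1 - X) times a factor in
    [0, 1].  It is divided by the square of the next theta, which is theta times
    1 - gamma p X >= 1 - p; one factor (1 - X) / theta is Y itself. *)
Lemma step_mean_sqr (b : R) s :
  step_mean (fun t => (hist_Y t - b) ^+ 2) s <=
  (hist_Y s - b) ^+ 2
  + (1 - p) ^- 2 * gam s ^+ 2 / hist_theta s * hist_Y s.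
Proof.
have /andP[X0 X1] := arm_state01 s.
have /andP[g0 g1] := gam01 (size s).
have /andP[p0 p1] := gap01.
have t0 := hist_theta_gt0 s.
have r0 := hist_rate_gt0 s.
have /andP[rp _] := hist_rate_bounds s; have [*] := arm_probs.
have tn := lt0r_neq0 t0; have rn := lt0r_neq0 r0.
have -> : step_mean (fun t => (hist_Y t - b) ^+ 2) s =
  (hist_Y s - b) ^+ 2
  + (1 - gam s * p * arm_state s) ^- 2 * gam s ^+ 2 / hist_theta s * hist_Y s *
    (arm_state s * (pA * (1 - arm_state s) + pB * arm_state s
         - p ^+ 2 * (arm_state s * (1 - arm_state s)))).
  rewrite /step_mean /hist_Y /=.
  by field; rewrite rn tn.
rewrite lerD2l.
set Z := gam s ^+ 2 / hist_theta s * hist_Y s.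
have Z0 : 0 <= Z.
  have := ltW (hist_Y_gt0 s); have := ltW t0 => ? ?.
  by apply: mulr_ge0 => //; apply: divr_ge0 => //; apply: sqr_ge0.
have : 0 <= arm_state s * (pA * (1 - arm_state s) + pB * arm_state s
         - p ^+ 2 * (arm_state s * (1 - arm_state s))) <= 1.
  set X := arm_state s in X0 X1 *.
  have X1' : 0 < 1 - X by lra.
  have h1 := mulr_gt0 X0 X1'.
  have h2 : p ^+ 2 <= pA by nra.
  have h3 : X * (1 - X) <= 1 - X by nra.
  have h4 : p ^+ 2 * (X * (1 - X)) <= pA * (1 - X).
    by rewrite ler_pM// ?sqr_ge0// ltW.
  have h5 : 0 <= p ^+ 2 * (X * (1 - X)) by rewrite mulr_ge0 ?sqr_ge0 ?ltW.
  have h6 : pA * (1 - X) + pB * X <= 1 by nra.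
  have h7 := mulr_gt0 (pB_gt0 par) X0.
  by apply/andP; split; nra.
set V := arm_state s * (_ - _) => /andP[V0 V1].
set k := 1 - _ in rn r0 rp *.
have -> : k ^- 2 * gam s ^+ 2 / hist_theta s * hist_Y s * V = k ^- 2 * (Z * V).
  by rewrite /Z !mulrA.
have -> : (1 - p) ^- 2 * gam s ^+ 2 / hist_theta s * hist_Y s = (1 - p) ^- 2 * Z.
  by rewrite /Z !mulrA.
apply: ler_pM; [by rewrite invr_ge0 sqr_ge0 | exact: mulr_ge0 | |
  exact: ler_piMr].
rewrite lef_pV2 ?posrE ?exprn_gt0//; last by lra.
by rewrite lerXn2r// nnegrE; lra.
Qed.

(** Up to the division by 1 - gamma p X, the drift and the variance of X change
    X (1 - X) by gamma p (1 - 2 X) - gamma^2 (pA - p X).  Comparing with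
    1 - gamma p X leaves gamma p (1 - X) - gamma^2 (pA - p X) >= - gamma^2 pB,
    and pB / (1 - p) < 1 because pA < 1, so the factor is positive at every step. *)
Lemma step_mean_XY s :
  (1 - pB / (1 - p) * gam s ^+ 2) * (arm_state s * hist_Y s) <=
  step_mean (fun t => arm_state t * hist_Y t) s.
Proof.
have /andP[X0 X1] := arm_state01 s.
have /andP[g0 g1] := gam01 (size s).
have /andP[p0 p1] := gap01.
have t0 := hist_theta_gt0 s.
have r0 := hist_rate_gt0 s.
have /andP[rp _] := hist_rate_bounds s; have [*] := arm_probs.
have tn := lt0r_neq0 t0; have rn := lt0r_neq0 r0.
have -> : step_mean (fun t => arm_state t * hist_Y t) s =
  (1 + gam s * p - 2 * gam s * p * arm_state s
    - gam s ^+ 2 * (pA - p * arm_state s)) / (1 - gam s * p * arm_state s)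
  * (arm_state s * hist_Y s).
  rewrite /step_mean /hist_Y /=.
  by field; rewrite rn tn.
have XY0 : 0 < arm_state s * hist_Y s by rewrite mulr_gt0// hist_Y_gt0.
rewrite ler_pM2r// ler_pdivlMr//.
set X := arm_state s in X0 X1 r0 rp *; set g := gam s in g0 g1 r0 rp *.
have h1 : 0 <= g * (1 - g) * p * (1 - X).
  by rewrite !mulr_ge0//; lra.
have k0 : 0 < 1 - p by lra.
have h2 : pB / (1 - p) * g ^+ 2 * (1 - p) <= pB / (1 - p) * g ^+ 2 * (1 - g * p * X).
  by rewrite ler_wpM2l// mulr_ge0 ?sqr_ge0// divr_ge0// ltW.
have h3 : pB / (1 - p) * g ^+ 2 * (1 - p) = pB * g ^+ 2.
  by field; rewrite lt0r_neq0.
by nra.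
Qed.

(** The tangent line of the convex function 1 / (1 + y). *)
Lemma inverse_convex_ge (y z : R) : 0 <= y -> 0 <= z ->
  (1 + y)^-1 - (z - y) / (1 + y) ^+ 2 <= (1 + z)^-1.
Proof.
move=> y0 z0; rewrite -subr_ge0.
have -> : (1 + z)^-1 - ((1 + y)^-1 - (z - y) / (1 + y) ^+ 2) =
  (z - y) ^+ 2 / ((1 + y) ^+ 2 * (1 + z)).
  by field; apply/andP; split; apply: lt0r_neq0; lra.
by rewrite divr_ge0 ?sqr_ge0// mulr_ge0 ?sqr_ge0//; lra.
Qed.

(** Lower bound for the growth of the mean of 1 / (1 + Y) in one step: the chance
    pB (1 - X) of the upward move of Y, times the square (gamma X / theta)^2 of a
    lower bound for its size, times the second-order coefficient of 1 / (1 + y)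
    over a range of length [c]. *)
Definition inverse_gain (c : R) (s : seq letter) : R :=
  pB * gam s ^+ 2 * arm_state s ^+ 2 * hist_Y s / hist_theta s
  / ((1 + hist_Y s) ^+ 2 * (1 + hist_Y s + c)).

Lemma inverse_gain_ge0 (c : R) s : 0 <= c -> 0 <= inverse_gain c s.
Proof.
move=> c0; have Y0 := hist_Y_gt0 s; have t0 := hist_theta_gt0 s.
apply: divr_ge0; last by rewrite mulr_ge0 ?sqr_ge0//; lra.
have [/ltW pB0 _ _ _ _] := arm_probs.
apply: divr_ge0; last exact: ltW.
apply: (mulr_ge0 _ (ltW Y0)); apply: (mulr_ge0 _ (sqr_ge0 _)).
exact: mulr_ge0 pB0 (sqr_ge0 _).
Qed.

(** The first-order term vanishes since Y is a martingale, and the second-order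
    remainders are nonnegative; the one of the move where arm B wins is kept. *)
Lemma step_mean_inverse (c : R) s :
  2 * gam s / ((1 - p) * hist_theta s) <= c ->
  (1 + hist_Y s)^-1 + inverse_gain c s <=
  step_mean (fun t => (1 + hist_Y t)^-1) s.
Proof.
move=> hc.
have /andP[X0 X1] := arm_state01 s.
have /andP[g0 g1] := gam01 (size s).
have /andP[p0 p1] := gap01.
have t0 := hist_theta_gt0 s.
have r0 := hist_rate_gt0 s.
have /andP[rp r1] := hist_rate_bounds s; have [? ? ? ? ?] := arm_probs.
have tn := lt0r_neq0 t0; have rn := lt0r_neq0 r0.
have Y0 := hist_Y_gt0 s.
set y := hist_Y s in Y0 *.
pose f t := (1 + y)^-1 - (hist_Y t - y) / (1 + y) ^+ 2.
have fl l : f (l :: s) <= (1 + hist_Y (l :: s))^-1.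
  by apply: inverse_convex_ge; apply: ltW => //; apply: hist_Y_gt0.
have meanf : step_mean f s = (1 + y)^-1.
  have := step_mean_lin (- (1 + y) ^- 2) 1 hist_Y
    (cst ((1 + y)^-1 + y / (1 + y) ^+ 2)) s.
  rewrite step_mean_cst step_mean_Y mul1r -/y => meanE.
  transitivity (- (1 + y) ^- 2 * y + ((1 + y)^-1 + y / (1 + y) ^+ 2)); last ring.
  rewrite -meanE; congr step_mean; apply/funext => t.
  rewrite /f /cst; ring.
set z := hist_Y ((false, true) :: s).
set k := 1 - gam s * p * arm_state s in rn r0 rp r1 *.
have zE : z - y = gam s * arm_state s * (1 + p * (1 - arm_state s))
     / (hist_theta s * k).
  by rewrite /z /y /hist_Y /= -/k /k; field; rewrite rn tn.
have zge : gam s * arm_state s / hist_theta s <= z - y.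
  rewrite zE invfM mulrA.
  rewrite -[X in X <= _]mulr1 -!mulrA; do 2 rewrite ler_wpM2l ?(ltW X0) ?(ltW g0)//.
  rewrite mulrCA ler_wpM2l ?invr_ge0 ?(ltW t0)//.
  rewrite ler_pdivlMr// mul1r (le_trans r1)// lerDl mulr_ge0//; lra.
have zle : z - y <= c.
  apply: le_trans hc; rewrite zE.
  have h1 : gam s * arm_state s * (1 + p * (1 - arm_state s)) <= 2 * gam s.
    rewrite -mulrA [leRHS]mulrC ler_pM2l//; nra.
  apply: ler_pM => //.
  - by rewrite !mulr_ge0 ?(ltW X0) ?(ltW g0)// addr_ge0// mulr_ge0//; lra.
  - by rewrite invr_ge0 mulr_ge0 ?ltW.
  - rewrite lef_pV2 ?posrE ?mulr_gt0//; last lra.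
    by rewrite mulrC ler_wpM2l// ltW.
have d0 : 0 <= gam s * arm_state s / hist_theta s.
  by rewrite !mulr_ge0 ?invr_ge0 ?ltW.
have c0 : 0 <= c by lra.
have zgain : f ((false, true) :: s)
   + (gam s * arm_state s / hist_theta s) ^+ 2 / ((1 + y) ^+ 2 * (1 + y + c))
   <= (1 + z)^-1.
  rewrite /f -/z -lerBrDl.
  have z0 : 0 < z by apply: hist_Y_gt0.
  have -> : (1 + z)^-1 - ((1 + y)^-1 - (z - y) / (1 + y) ^+ 2) =
    (z - y) ^+ 2 / ((1 + y) ^+ 2 * (1 + z)).
    by field; apply/andP; split; apply: lt0r_neq0; lra.
  apply: ler_pM.
  - exact: sqr_ge0.
  - by rewrite invr_ge0 mulr_ge0 ?sqr_ge0//; lra.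
  - by rewrite lerXn2r// nnegrE; lra.
  - rewrite lef_pV2 ?posrE ?mulr_gt0 ?exprn_gt0//; try lra.
    by rewrite ler_pM2l ?exprn_gt0//; lra.
rewrite -meanf /step_mean.
have -> : inverse_gain c s = (1 - arm_state s) * (pB *
  ((gam s * arm_state s / hist_theta s) ^+ 2 / ((1 + y) ^+ 2 * (1 + y + c)))).
  have yE : y = (1 - arm_state s) / hist_theta s by [].
  have D0 : 1 + y + c != 0 by apply: lt0r_neq0; lra.
  have D1 : 1 + y != 0 by apply: lt0r_neq0; lra.
  rewrite /inverse_gain -/y.
  set D := (1 + y) ^+ 2 * (1 + y + c).
  have DN : D != 0 by rewrite mulf_neq0// expf_neq0.
  by rewrite yE; field; rewrite tn DN.
set G := _ / (_ * (1 + y + c)) in zgain *.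
have F1 := fl (true, true); have F2 := fl (true, false).
have F3 := fl (false, false).
have M1 : pA * f [:: (true, true) & s] <= pA * (1 + hist_Y [:: (true, true) & s])^-1.
  by rewrite ler_pM2l.
have M2 : (1 - pA) * f [:: (true, false) & s] <= (1 - pA) * (1 + hist_Y [:: (true, false) & s])^-1.
  by rewrite ler_pM2l//; lra.
have M3 : (1 - pB) * f [:: (false, false) & s] <= (1 - pB) * (1 + hist_Y [:: (false, false) & s])^-1.
  by rewrite ler_pM2l//; lra.
have M4 : pB * (f [:: (false, true) & s] + G) <= pB * (1 + z)^-1.
  by rewrite ler_pM2l.
rewrite -addrA -mulrDr; apply: lerD; apply: ler_wpM2l; [lra | lra | lra | ].
by rewrite -/z; lra.
Qed.

End HistoryTree.

(** * Estimates along the tree *)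

Section Estimates.
Variables (R : realType) (pA pB : R) (gamma : nat -> R) (x : R).
Hypothesis par : bandit_parameters pA pB gamma x.

Notation p := (pA - pB).
Notation gam s := (gamma (size s).+1).
Notation X := (arm_state gamma x).
Notation th := (hist_theta pA pB gamma x).
Notation Y := (hist_Y pA pB gamma x).
Notation Q := (step_mean pA pB gamma x).
Notation E := (hist_mean pA pB gamma x).
Notation G := (Gam gamma).

Definition sqr_gain_sum n : R := \sum_(1 <= k < n.+1) gamma k ^+ 2.
(** The general term of the series that separates the two regimes. *)
Definition critical_term n : R := gamma n ^+ 2 * expR (p * G n).

Lemma GamS n : G n.+1 = G n + gamma n.+1.
Proof. by rewrite /Gam big_nat_recr. Qed.

Lemma Gam_ge0 n : 0 <= G n.
Proof.
rewrite /Gam big_nat_cond sumr_ge0// => k /andP[/andP[k1 _] _].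
by have /andP[/ltW] := gain01 par k1.
Qed.

Lemma critical_term_ge0 n : 0 <= critical_term n.
Proof. by rewrite mulr_ge0 ?sqr_ge0 ?expR_ge0. Qed.

Lemma critical_term_gt0 n : 0 < critical_term n.+1.
Proof. by have /andP[g0 _] := gam01 par n; rewrite mulr_gt0 ?exprn_gt0 ?expR_gt0. Qed.

Lemma sqr_gain_sumS n : sqr_gain_sum n.+1 = sqr_gain_sum n + gamma n.+1 ^+ 2.
Proof. by rewrite /sqr_gain_sum big_nat_recr. Qed.

(** Compare each factor 1 - gamma p X with exp (- gamma p), at a cost of second
    order. *)
Lemma inv_theta_le s :
  (th s)^-1 <= expR (p * G (size s) + (1 - p)^-1 * sqr_gain_sum (size s)).
Proof.
have /andP[p0 p1] := gap01 par.
elim: s => [|l s IH] /=.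
  by rewrite /Gam /sqr_gain_sum !big_geq// !mulr0 addr0 expR0 invr1.
have /andP[X0 X1] := arm_state01 par s.
have /andP[g0 g1] := gam01 par (size s).
have t0 := hist_theta_gt0 par s.
have r0 := hist_rate_gt0 par s.
rewrite invfM GamS sqr_gain_sumS.
set u := gam s * p * X s in r0 *.
have u0 : 0 <= u by rewrite /u !mulr_ge0// ltW.
have ugp : u <= p * gam s 
  by rewrite /u [leRHS]mulrC ler_piMr ?(ltW X1)// mulr_ge0 ?ltW.
have up : u <= p by nra.
have ug : u ^+ 2 <= gam s ^+ 2 by rewrite lerXn2r// ?nnegrE ?(ltW g0)//; nra.
have h := invr_1B_le_expR u0 up p1.
apply: le_trans (_ : expR (p * G (size s) + (1 - p)^-1 * sqr_gain_sum (size s)) *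
   expR (u + u ^+ 2 / (1 - p)) <= _).
  by rewrite ler_pM// ?invr_ge0 ltW.
rewrite -expRD ler_expR.
have : u ^+ 2 / (1 - p) <= gam s ^+ 2 / (1 - p).
  by rewrite ler_wpM2r// invr_ge0; lra.
rewrite !mulrDr [_^-1 * gam s ^+ 2]mulrC; lra.
Qed.

Section SummableSquares.
Variable B : R.
Hypothesis hB : forall n, sqr_gain_sum n <= B.

Lemma inv_theta_le_expR s : (th s)^-1 <= expR (B / (1 - p)) * expR (p * G (size s)).
Proof.
apply: le_trans (inv_theta_le s) _.
have /andP[p0 p1] := gap01 par.
rewrite -expRD ler_expR addrC lerD2r mulrC ler_wpM2r// invr_ge0; lra.
Qed.

Definition var_const : R := (1 - p) ^- 2 * expR (B / (1 - p)).

Lemma var_const_ge0 : 0 <= var_const.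
Proof. by rewrite mulr_ge0 ?expR_ge0// invr_ge0 sqr_ge0. Qed.

Lemma step_mean_sqr_le (b : R) s :
  Q (fun t => (Y t - b) ^+ 2) s <=
  (Y s - b) ^+ 2 + var_const * critical_term (size s).+1 * Y s.
Proof.
apply: le_trans (step_mean_sqr par b s) _.
have /andP[p0 p1] := gap01 par.
have /andP[g0 g1] := gam01 par (size s).
have Y0 := hist_Y_gt0 par s.
rewrite lerD2l ler_pM2r//.
have -> : var_const * critical_term (size s).+1 = (1 - p) ^- 2 * gam s ^+ 2 *
  (expR (B / (1 - p)) * expR (p * G (size s).+1)).
  rewrite /var_const /critical_term; ring.
apply: ler_wpM2l; first by apply: mulr_ge0; rewrite ?invr_ge0 sqr_ge0.
apply: le_trans (inv_theta_le_expR s) _.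
rewrite ler_wpM2l ?expR_ge0// ler_expR ler_pM2l// GamS lerDl ltW//.
Qed.

Lemma hist_mean_sqr_le n :
  E n (fun s => Y s ^+ 2) <= 1 + var_const * \sum_(1 <= k < n.+1) critical_term k.
Proof.
have /andP[x0 x1] := start01 par.
elim: n => [|n IH].
  rewrite /= /hist_Y /= divr1 big_geq// mulr0 addr0; nra.
rewrite big_nat_recr//= mulrDr addrA.
apply: le_trans (_ : E n (fun s => 1 * Y s ^+ 2 + var_const * critical_term n.+1 * Y s) <= _).
  apply: (hist_mean_le par) => s sn.
  have := step_mean_sqr_le 0 s; rewrite sn subr0 /= mul1r.
  by under eq_fun do rewrite subr0.
rewrite (hist_mean_lin par) mul1r (hist_mean_Y par) lerD//.
have := mulr_ge0 var_const_ge0 (critical_term_ge0 n.+1); nra.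
Qed.

(** Iterates [step_mean_XY], with 1 - k gamma^2 >= exp (- k / (1 - k) gamma^2) and
    k / (1 - k) = pB / (1 - pA) for k = pB / (1 - p). *)
Lemma hist_mean_XY_ge n :
  x * (1 - x) * expR (- (pB / (1 - pA)) * sqr_gain_sum n) <=
  E n (fun s => X s * Y s).
Proof.
have /andP[x0 x1] := start01 par.
have [b0 b1 a0 a1 ba] := arm_probs par.
elim: n => [|n IH].
  by rewrite /= /hist_Y /= divr1 /sqr_gain_sum big_geq// mulr0 expR0 mulr1.
have /andP[g0 g1] := gam01 par n.
set k := pB / (1 - p).
have k0 : 0 <= k by rewrite divr_ge0//; lra.
have k1 : k < 1 by rewrite ltr_pdivrMr; lra.
have g2 : gamma n.+1 ^+ 2 <= 1 by rewrite expr_le1// ltW.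
have kg : k * gamma n.+1 ^+ 2 <= k by nra.
have kg0 : 0 <= k * gamma n.+1 ^+ 2 by rewrite mulr_ge0 ?sqr_ge0.
have h : expR (- (pB / (1 - pA)) * gamma n.+1 ^+ 2) <= 1 - k * gamma n.+1 ^+ 2.
  rewrite mulNr expRN invf_ple ?posrE ?expR_gt0//; last lra.
  apply: le_trans (expR_ge1Dx _).
  apply: le_trans (_ : 1 + k * gamma n.+1 ^+ 2 / (1 - k) <= _).
    have -> : (1 - k * gamma n.+1 ^+ 2)^-1 =
       1 + k * gamma n.+1 ^+ 2 / (1 - k * gamma n.+1 ^+ 2).
      by field; apply: lt0r_neq0; lra.
    by rewrite lerD2l ler_wpM2l// lef_pV2 ?posrE; lra.
  rewrite lerD2l mulrAC.
  suff -> : k / (1 - k) = pB / (1 - pA) by [].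
  by rewrite /k; field; do ?(apply/andP; split); apply: lt0r_neq0; lra.
have -> : x * (1 - x) * expR (- (pB / (1 - pA)) * sqr_gain_sum n.+1) =
   expR (- (pB / (1 - pA)) * gamma n.+1 ^+ 2)
    * (x * (1 - x) * expR (- (pB / (1 - pA)) * sqr_gain_sum n)).
  rewrite sqr_gain_sumS (mulrDr (- _)) expRD; ring.
have I0 : 0 <= x * (1 - x) * expR (- (pB / (1 - pA)) * sqr_gain_sum n).
  by rewrite !mulr_ge0 ?expR_ge0//; lra.
apply: le_trans (_ : (1 - k * gamma n.+1 ^+ 2) * E n (fun s => X s * Y s) <= _).
  by rewrite ler_pM ?expR_ge0.
have -> : (1 - k * gamma n.+1 ^+ 2) * E n (fun s => X s * Y s) =
  E n (fun s => (1 - k * gamma n.+1 ^+ 2) * (X s * Y s) + 0 * (X s * Y s)).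
  by rewrite (hist_mean_lin par) mul0r addr0.
apply: (hist_mean_le par) => s sn /=; rewrite mul0r addr0 -sn.
exact: step_mean_XY.
Qed.

Section FirstPassage.
Variables (rho : nat -> R) (K : R).
Hypotheses (K0 : 0 < K) (rho_ge0 : forall n, 0 <= rho n)
  (rhoS : forall n, rho n = critical_term n.+1 + rho n.+1).

(** The value of Y when it first exceeds K rho, and 0 before that time; Y is
    positive, so 0 is not ambiguous. *)
Fixpoint passage_value (s : seq letter) : R :=
  let enter := if K * rho (size s) < Y s then Y s else 0 in
  if s is _ :: s' then
    if passage_value s' == 0 then enter else passage_value s'
  else enter.

Definition passage_dev (s : seq letter) : R :=
  if passage_value s == 0 then 0 else (Y s / passage_value s - 1) ^+ 2.

(** The squared deviation after the passage is compensated by the variance that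
    the remaining steps can still produce, at most C rho_n Y_n / v^2.  At the
    passage time this is C rho_n / Y_n <= C / K, so the constant C / K before it
    makes a supermartingale. *)
Definition passage_potential (s : seq letter) : R :=
  if passage_value s == 0 then var_const / K
  else passage_dev s + var_const * rho (size s) * Y s / passage_value s ^+ 2.

Lemma passage_potential_enter s :
  passage_value s = (if K * rho (size s) < Y s then Y s else 0) ->
  passage_potential s <= var_const / K.
Proof.
have Y0 := hist_Y_gt0 par s; have C0 := var_const_ge0.
rewrite /passage_potential /passage_dev => ->; case: ltP => [h|_]; last by rewrite eqxx.
rewrite (negbTE (lt0r_neq0 Y0)) divff ?lt0r_neq0// subrr expr0n add0r.
have -> : var_const * rho (size s) * Y s / Y s ^+ 2 = var_const * (rho (size s) / Y s).
  by field; apply: lt0r_neq0.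
by rewrite ler_wpM2l// ler_pdivrMr// mulrC ler_pdivlMr// mulrC ltW.
Qed.

Lemma step_mean_passage_potential s : Q passage_potential s <= passage_potential s.
Proof.
have [v0|v0] := eqVneq (passage_value s) 0.
  rewrite {2}/passage_potential v0 eqxx -[leRHS](step_mean_cst pA pB gamma x _ s).
  by apply: (step_mean_le par) => l; apply: passage_potential_enter; rewrite /= v0 eqxx.
set b := passage_value s in v0.
have pv l : passage_value (l :: s) = b by rewrite /= -/b (negbTE v0).
have -> : Q passage_potential s = Q (fun t => b ^- 2 * (Y t - b) ^+ 2 +
    (b ^- 2 * var_const * rho (size s).+1) * Y t) s.
  by rewrite /step_mean /passage_potential /passage_dev !pv (negbTE v0) /=; field.
rewrite step_mean_lin (step_mean_Y par).
have b2 : 0 <= b ^- 2 by rewrite invr_ge0 sqr_ge0.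
apply: le_trans (lerD (ler_wpM2l b2 (step_mean_sqr_le b s)) (lexx _)) _.
rewrite /passage_potential /passage_dev -/b (negbTE v0) (rhoS (size s)).
by rewrite le_eqVlt; apply/orP; left; apply/eqP; field.
Qed.

Lemma hist_mean_passage_dev n : E n passage_dev <= var_const / K.
Proof.
apply: le_trans (_ : E n passage_potential <= _).
  apply: (hist_mean_le par) => s _; rewrite /passage_potential /passage_dev.
  case: ifPn => _; first by rewrite divr_ge0 ?var_const_ge0 ?ltW.
  rewrite lerDl; apply: divr_ge0; last exact: sqr_ge0.
  apply: (mulr_ge0 _ (ltW (hist_Y_gt0 par s))).
  exact: (mulr_ge0 var_const_ge0 (rho_ge0 _)).
apply: (hist_mean_supermartingale par); first exact: step_mean_passage_potential.
exact: passage_potential_enter.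
Qed.

End FirstPassage.
End SummableSquares.

Lemma sqr_gain_sum_le_critical n : sqr_gain_sum n <= \sum_(1 <= k < n.+1) critical_term k.
Proof.
have /andP[p0 p1] := gap01 par.
apply: ler_sum => k _; rewrite /critical_term ler_peMr ?sqr_ge0//.
by rewrite -expR0 ler_expR mulr_ge0 ?Gam_ge0// ltW.
Qed.

(** Riemann sum comparison with the integral of M exp (- p t) over t = Gamma:
    gamma_k exp (- p Gamma_k) is at most
    (exp (- p Gamma_(k-1)) - exp (- p Gamma_k)) / p. *)
Lemma sqr_gain_sum_bounded (M : R) n :
  (forall n, (1 <= n)%N -> gamma n * expR (p * G n) <= M) ->
  sqr_gain_sum n <= M / p.
Proof.
move=> hM; have /andP[p0 p1] := gap01 par.
suff: sqr_gain_sum n <= M / p * (1 - expR (- (p * G n))).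
  move=> h; apply: le_trans h _.
  have M0 : 0 <= M.
    apply: le_trans (hM 1%N isT); rewrite mulr_ge0 ?expR_ge0//.
    by have /andP[/ltW] := gam01 par 0.
  by rewrite ler_piMr ?divr_ge0 ?(ltW p0)//.
elim: n => [|n IH].
  by rewrite /sqr_gain_sum /Gam !big_geq// mulr0 oppr0 expR0 subrr mulr0.
rewrite sqr_gain_sumS; apply: le_trans (lerD IH (lexx _)) _.
have /andP[g0 g1] := gam01 par n.
have h1 : gamma n.+1 <= M * expR (- (p * G n.+1)).
  by rewrite expRN ler_pdivlMr ?expR_gt0// hM.
have h2 : p * gamma n.+1 * expR (- (p * G n.+1)) <=
   expR (- (p * G n)) - expR (- (p * G n.+1)).
  have -> : - (p * G n) = - (p * G n.+1) + p * gamma n.+1 by rewrite GamS; ring.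
  rewrite expRD.
  have := ler_wpM2l (expR_ge0 (- (p * G n.+1))) (expR_ge1Dx (p * gamma n.+1)).
  lra.
have h3 : gamma n.+1 ^+ 2 <= M * (gamma n.+1 * expR (- (p * G n.+1))).
  by rewrite expr2 mulrCA ler_pM2l.
have h4 : M * (gamma n.+1 * expR (- (p * G n.+1))) <=
  M / p * (expR (- (p * G n)) - expR (- (p * G n.+1))).
  rewrite -mulrA ler_wpM2l//.
    apply: le_trans (hM 1%N isT); rewrite mulr_ge0 ?expR_ge0//.
    by have /andP[/ltW] := gam01 par 0.
  by rewrite ler_pdivlMl// mulrA.
have := le_trans h3 h4; lra.
Qed.

(** The gains telescope in the mean of 1 / (1 + Y), which is at most 1. *)
Lemma hist_mean_inverse_gain_sum (c : R) n :
  (forall s, 2 * gam s / ((1 - p) * th s) <= c) ->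
  \sum_(0 <= k < n) E k (inverse_gain pA pB gamma x c) <= 1.
Proof.
move=> hc.
suff: \sum_(0 <= k < n) E k (inverse_gain pA pB gamma x c) <= E n (fun t => (1 + Y t)^-1).
  move/le_trans; apply.
  rewrite -[leRHS](hist_mean_cst par n); apply: (hist_mean_le par) => s _.
  by rewrite invf_le1; have := hist_Y_gt0 par s; lra.
elim: n => [|n IH].
  rewrite big_geq// /= invr_ge0; have := hist_Y_gt0 par [::]; lra.
rewrite big_nat_recr//=; apply: le_trans (lerD IH (lexx _)) _.
rewrite -[X in X + _]mul1r -[X in _ + X]mul1r -(hist_mean_lin par).
by apply: (hist_mean_le par) => s _; rewrite !mul1r; apply: step_mean_inverse.
Qed.

(** Along a trajectory with X >= 1/2 and y / 2 <= Y <= 2 y from time [N] on,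
    theta_k exp (p Gamma_k) stays bounded: one step multiplies it at most by
    exp (p gamma (1 - X)) with 1 - X = Y theta <= 2 y theta, while
    gamma p theta / 2 is at most the decrease of theta.  Hence
    theta exp (p Gamma + 4 y theta) is nonincreasing. *)
Lemma inverse_gain_critical_term (c : R) (h : nat -> seq letter) (y : R) N :
  0 <= c -> 0 < y -> (forall k, exists l, h k.+1 = l :: h k) ->
  (forall k, size (h k) = k) ->
  (forall k, (N <= k)%N -> [/\ 1/2 <= X (h k), y / 2 <= Y (h k) & Y (h k) <= 2 * y]) ->
  exists2 C : R, 0 < C &
    forall k, (N <= k)%N -> C * critical_term k.+1 <= inverse_gain pA pB gamma x c (h k).
Proof.
move=> c0 y0 hS hsz hN.
have /andP[p0 p1] := gap01 par; have [b0 b1 a0 a1 ba] := arm_probs par.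
pose L k := th (h k) * expR (p * G k + 4 * y * th (h k)).
have Ldecr k : (N <= k)%N -> L k.+1 <= L k.
  move=> /hN[X2 _ Y2]; have [l hl] := hS k.
  rewrite /L hl hist_theta_cons hsz GamS.
  have t0 := hist_theta_gt0 par (h k).
  have /andP[X0 X1] := arm_state01 par (h k).
  have /andP[g0 g1] := gam01 par k.
  set t := th (h k) in t0 *; set z := X (h k) in X0 X1 X2 *.
  have zE : 1 - z = Y (h k) * t by rewrite /hist_Y divfK ?lt0r_neq0.
  set u := gamma k.+1 * p * z.
  rewrite -mulrA ler_pM2l//.
  apply: le_trans (_ : expR (- u) * expR (p * (G k + gamma k.+1) + 4 * y * (t * (1 - u))) <= _).
    by rewrite ler_wpM2r ?expR_ge0//; have := expR_ge1Dx (- u).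
  rewrite -expRD ler_expR.
  have h1 : u + gamma k.+1 * p * (1 - z) = gamma k.+1 * p by rewrite /u; ring.
  have h2 : gamma k.+1 * p * (1 - z) <= gamma k.+1 * p * (2 * y * t).
    by rewrite zE ler_pM2l ?ler_pM2r ?mulr_gt0.
  have h3 : gamma k.+1 * p * (1 / 2) * (4 * y * t) <= u * (4 * y * t).
    by rewrite ler_pM2r ?mulr_gt0// /u ler_pM2l ?mulr_gt0.
  lra.
have Lle k : (N <= k)%N -> L k <= L N.
  elim: k => [|k IH]; first by rewrite leqn0 => /eqP->.
  rewrite leq_eqVlt ltnS => /predU1P[->//|Nk].
  exact: le_trans (Ldecr _ Nk) (IH Nk).
have L0 : 0 < L N by rewrite mulr_gt0 ?expR_gt0// hist_theta_gt0.
have D0 : 0 < (1 + 2 * y) ^+ 2 * (1 + 2 * y + c).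
  by rewrite mulr_gt0 ?exprn_gt0//; lra.
(* The lower bounds 1 / 2 and y / 2 replace X and Y in the numerator, 2 y replaces
   Y in the denominator, theta exp (p Gamma) is at most L N, and exp p pays for
   passing from Gamma_k to Gamma_(k+1). *)
exists (pB * (1 / 2) ^+ 2 * (y / 2) / L N / expR p
          / ((1 + 2 * y) ^+ 2 * (1 + 2 * y + c))).
  apply: divr_gt0 => //; apply: divr_gt0; last exact: expR_gt0.
  apply: divr_gt0 => //; apply: mulr_gt0; last lra.
  by apply: mulr_gt0 => //; apply: exprn_gt0; lra.
move=> k Nk; have [X2 Y1 Y2] := hN _ Nk.
have t0 := hist_theta_gt0 par (h k).
have g0 : 0 < gamma k.+1 by have /andP[] := gam01 par k.
have Y0 := hist_Y_gt0 par (h k).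
rewrite /inverse_gain /critical_term hsz.
have tE : expR (p * G k) / L N <= (th (h k))^-1.
  rewrite ler_pdivrMr// ler_pdivlMl//.
  apply: le_trans (Lle _ Nk); rewrite /L ler_pM2l// ler_expR lerDl !mulr_ge0// ltW//.
have eE : expR (p * G k.+1) / expR p <= expR (p * G k).
  rewrite -expRN -expRD ler_expR GamS.
  have /andP[_ g1] := gam01 par k; nra.
have -> : pB * (1 / 2) ^+ 2 * (y / 2) / L N / expR p
   / ((1 + 2 * y) ^+ 2 * (1 + 2 * y + c)) * (gamma k.+1 ^+ 2 * expR (p * G k.+1)) =
   pB * gamma k.+1 ^+ 2 * (1 / 2) ^+ 2 * (y / 2)
   * (expR (p * G k.+1) / expR p / L N) / ((1 + 2 * y) ^+ 2 * (1 + 2 * y + c)).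
  set D := (1 + 2 * y) ^+ 2 * _ in D0 *.
  by field; rewrite !lt0r_neq0 ?expR_gt0.
have g2 : 0 <= pB * gamma k.+1 ^+ 2 by apply: (mulr_ge0 (ltW b0)); apply: sqr_ge0.
have q0 : 0 <= (1 / 2 : R) ^+ 2 by apply: sqr_ge0.
have y1 : 0 <= y / 2 by lra.
have e0 : 0 <= expR (p * G k.+1) / expR p / L N.
  by rewrite !divr_ge0 ?expR_ge0// ltW.
apply: ler_pM.
- exact: (mulr_ge0 (mulr_ge0 (mulr_ge0 g2 q0) y1) e0).
- by rewrite invr_ge0 ltW.
- apply: ler_pM (mulr_ge0 (mulr_ge0 g2 q0) y1) e0 _ _; last first.
    by apply: le_trans tE; rewrite ler_wpM2r// invr_ge0 ltW.
  apply: ler_pM (mulr_ge0 g2 q0) y1 _ Y1.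
  by rewrite ler_wpM2l// lerXn2r// nnegrE; lra.
- rewrite lef_pV2 ?posrE// ?mulr_gt0 ?exprn_gt0//; try lra.
  apply: ler_pM; [exact: sqr_ge0 | lra | | lra].
  by rewrite lerXn2r ?nnegrE//; lra.
Qed.

End Estimates.

(** * The law of the observed history *)

Lemma sigma_family_bigcap (d : measure_display) (T : measurableType d) (I : choiceType)
    (D : set I) (F : I -> set_system T) (J : seq I) (E : I -> set T) :
  (forall i, i \in J -> D i /\ F i (E i)) ->
  sigma_family D F (\bigcap_(i in [set` J]) E i).
Proof.
move=> h.
apply: (@fin_bigcap_measurable _ (g_sigma_algebraType (\bigcup_(i in D) F i))).
  exact: finite_seq.
move=> i /h [Di FE]; apply: sub_sigma_algebra; by exists i.
Qed.

Lemma uniform_prob_le (R : realType) (c : R) : 0 <= c <= 1 ->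
  uniform_prob (@ltr01 R) [set y | y <= c] = c%:E.
Proof.
move=> /andP[c0 c1].
rewrite /uniform_prob integral_uniform_pdf.
have -> : [set y | y <= c] `&` `[0, 1] = `[0, c]%classic :> set R.
  apply/seteqP; split=> y /=; rewrite !in_itv/=.
    by move=> [yc /andP[y0 y1]]; rewrite y0 yc.
  by move=> /andP[y0 yc]; rewrite y0 yc (le_trans yc).
rewrite (eq_integral (fun=> 1%:E)); last first.
  move=> y; rewrite inE/= in_itv/= => /andP[y0 yc].
  by rewrite /uniform_pdf y0 (le_trans yc c1)/= subr0 invr1.
rewrite integral_cst//= mul1e lebesgue_measure_itv/= lte_fin.
by case: ltP => h; rewrite ?oppr0 ?adde0//; congr _%:E; apply/eqP; rewrite eq_le c0 h.
Qed.

Section ObservedHistory.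
Variables (R : realType) (d : measure_display) (T : measurableType d)
  (P : probability T R) (pA pB : R) (gamma : nat -> R) (x : R).
Hypothesis par : bandit_parameters pA pB gamma x.
Variables (U : nat -> {RV P >-> R}) (A B : nat -> set T).
Hypotheses
  (hU : forall n, (1 <= n)%N -> forall S : set R, measurable S ->
    distribution P (U n) S = uniform_prob (@ltr01 R) S)
  (hUind : mutually_independent P ge1 (fun n => sigma_rv (U n)))
  (mA : forall n, (1 <= n)%N -> measurable (A n))
  (mB : forall n, (1 <= n)%N -> measurable (B n))
  (hA : forall n, (1 <= n)%N -> P (A n) = pA%:E)
  (hB : forall n, (1 <= n)%N -> P (B n) = pB%:E)
  (hABind : mutually_independent P ge1
    (fun n => sigma_rv (indic_pair R (A n) (B n))))
  (hABU : independent_systems P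
    (sigma_family ge1 (fun n => sigma_rv (indic_pair R (A n) (B n))))
    (sigma_family ge1 (fun n => sigma_rv (U n)))).

Notation p := (pA - pB).
Notation X := (arm_state gamma x).
Notation th := (hist_theta pA pB gamma x).
Notation Y := (hist_Y pA pB gamma x).
Notation Q := (step_mean pA pB gamma x).
Notation E := (hist_mean pA pB gamma x).

Fixpoint history (n : nat) (w : T) : seq letter :=
  if n is m.+1 then
    let s := history m w in
    let u := U m.+1 w <= X s in
    (u, if u then w \in A m.+1 else w \in B m.+1) :: s
  else [::].

Lemma size_history n w : size (history n w) = n.
Proof. by elim: n => //= n ->. Qed.

Lemma bandit_history n w : bandit gamma U A B x n w = X (history n w).
Proof.
elim: n => //= n IH; rewrite IH size_history; congr (_ + _ * _).
have in1 : (w \in [set v | U n.+1 v <= bandit gamma U A B x n v] `&` A n.+1) =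
    (U n.+1 w <= X (history n w)) && (w \in A n.+1).
  by rewrite in_setI -IH; congr (_ && _); apply/idP/idP => [/set_mem|h]; rewrite ?inE.
have in2 : (w \in [set v | bandit gamma U A B x n v < U n.+1 v] `&` B n.+1) =
    (X (history n w) < U n.+1 w) && (w \in B n.+1).
  by rewrite in_setI -IH; congr (_ && _); apply/idP/idP => [/set_mem|h]; rewrite ?inE.
rewrite !indicE in1 in2 ltNge.
by case: (_ <= _).
Qed.

Lemma theta_history n w :
  theta p gamma (bandit gamma U A B x) n w = th (history n w).
Proof.
rewrite /theta; elim: n => [|n IH] /=; first by rewrite big_geq.
by rewrite big_nat_recr//= IH bandit_history size_history.
Qed.

Lemma Ymart_history n w :
  Ymart p gamma (bandit gamma U A B x) n w = Y (history n w).
Proof. by rewrite /Ymart theta_history bandit_history. Qed.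

Definition gate (c : R) (u : bool) : set R :=
  if u then [set y | y <= c] else ~` [set y | y <= c].

Definition outcome (n : nat) (l : letter) : set T :=
  let C := if l.1 then A n else B n in if l.2 then C else ~` C.

Fixpoint gate_event (s : seq letter) (i : nat) : set T :=
  if s is l :: s' then
    if i == (size s').+1 then U i @^-1` gate (X s') l.1 else gate_event s' i
  else setT.

Fixpoint outcome_event (s : seq letter) (i : nat) : set T :=
  if s is l :: s' then
    if i == (size s').+1 then outcome i l else outcome_event s' i
  else setT.

Fixpoint gate_weight (s : seq letter) : R :=
  if s is l :: s' then
    (if l.1 then X s' else 1 - X s') * gate_weight s'
  else 1.

Fixpoint outcome_weight (s : seq letter) : R :=
  if s is l :: s' then
    (let q := if l.1 then pA else pB in if l.2 then q else 1 - q)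
      * outcome_weight s'
  else 1.

Lemma measurable_gate c u : measurable (gate c u).
Proof.
have m : measurable [set y : R | y <= c].
  have -> : [set y : R | y <= c] = `]-oo, c]%classic.
    by apply/seteqP; split=> y /=; rewrite in_itv.
  exact: measurable_itv.
by case: u => //=; apply: measurableC.
Qed.

Lemma measurable_gate_event s i : measurable (gate_event s i).
Proof.
elim: s => //= l s IH; case: ifP => // _.
by apply: measurable_funPTI => //; exact: measurable_gate.
Qed.

Lemma measurable_outcome n l : (1 <= n)%N -> measurable (outcome n l).
Proof.
move=> n1; rewrite /outcome; case: l => -[] [] /=;
  by try apply: measurableC; [apply: mA || apply: mB].
Qed.

Lemma measurable_outcome_event s i : (1 <= i)%N -> measurable (outcome_event s i).
Proof.
by move=> i1; elim: s => //= l s IH; case: ifP => // _; apply: measurable_outcome.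
Qed.

Lemma gate_event_sigma s i : sigma_rv (U i) (gate_event s i).
Proof.
elim: s => [|l s IH] /=; first by exists setT => //; rewrite preimage_setT setIT.
case: ifP => // _; exists (gate (X s) l.1); first exact: measurable_gate.
by rewrite setTI.
Qed.

Lemma outcome_event_sigma s i :
  sigma_rv (indic_pair R (A i) (B i)) (outcome_event s i).
Proof.
elim: s => [|l s IH] /=; first by exists setT => //; rewrite preimage_setT setIT.
case: ifP => // _.
pose S := (if l.1 then fst else snd) @^-1` [set (1 : R)] : set (R * R).
have mS : measurable S.
  rewrite /S; case: (l.1); rewrite -[X in measurable X]setTI.
    exact: (@measurable_fst _ _ _ _ measurableT).
  exact: (@measurable_snd _ _ _ _ measurableT).
have SE : indic_pair R (A i) (B i) @^-1` S = if l.1 then A i else B i.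
  have ind1 (C : set T) w : (\1_C w = 1 :> R) = C w.
    apply/propext; split=> [|Cw]; last by rewrite indicE mem_set.
    rewrite indicE; case: (boolP (w \in C)) => [/set_mem//|_ /eqP].
    by rewrite eq_sym oner_eq0.
  by rewrite /S /indic_pair; apply/seteqP; split=> w; case: (l.1) => /=; rewrite ind1.
rewrite /outcome; case: (l.2).
  by exists S => //; rewrite setTI.
by exists (~` S); [exact: measurableC | rewrite setTI -preimage_setC SE].
Qed.

(** The thresholds X_(i-1) depend on the history, but on the event that the
    history is [s] they are the numbers prescribed by [s]; this turns the event into
    an intersection of events of the single variables. *)
Lemma historyP s w : history (size s) w = s <->
  forall i, (1 <= i <= size s)%N -> gate_event s i w /\ outcome_event s i w.
Proof.
elim: s => [|[u a] s IH] /=.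
  by split=> // _ i; rewrite leqn0 => /andP[/lt0n_neq0/negbTE->].
set G := gate_event ((u, a) :: s); set O := outcome_event ((u, a) :: s).
have Gold i : (1 <= i <= size s)%N -> i == (size s).+1 = false.
  by move=> /andP[_ h]; apply/negbTE; rewrite neq_ltn ltnS h.
split.
- move=> [hu ha hs]; move: (hs) => /IH hE i /andP[i1].
  rewrite hs in hu ha; rewrite hu in ha.
  rewrite leq_eqVlt ltnS => /predU1P[->|si].
    rewrite eqxx /gate /outcome /=; split.
      by case: u hu {ha G O Gold} => //= /negbT/negP.
    by case: u a ha {hu G O Gold} => -[] /= => [/set_mem|/negbT/negP h /mem_set|
      /set_mem|/negbT/negP h /mem_set].
  by rewrite Gold ?i1//; apply: hE; rewrite i1.
- move=> hE.
  have hs : history (size s) w = s.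
    apply/IH => i si; have := hE i; rewrite Gold//; apply.
    by case/andP: si => -> /leqW.
  have [] := hE (size s).+1; rewrite ?leqnn ?ltnS// eqxx hs.
  rewrite /gate /outcome /preimage /= => hu ha.
  have -> : (U (size s).+1 w <= X s) = u.
    by case: u hu {ha G O hE Gold} => //= /negP/negbTE.
  congr ((_, _) :: _); case: u a ha {hu G O hE Gold} => -[] /=.
  - by move=> h; rewrite mem_set.
  - by move=> h; rewrite memNset.
  - by move=> h; rewrite mem_set.
  - by move=> h; rewrite memNset.
Qed.

Definition history_event s : set T :=
  (\bigcap_(i in [set` index_iota 1 (size s).+1]) outcome_event s i) `&`
  (\bigcap_(i in [set` index_iota 1 (size s).+1]) gate_event s i).

Lemma history_eventE s : [set w | history (size s) w = s] = history_event s.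
Proof.
apply/seteqP; split=> w /=.
  move/historyP => h; split=> i /=; rewrite mem_index_iota ltnS => /h []//.
move=> [ho hg]; apply/historyP => i hi; split.
  by apply: hg; rewrite /= mem_index_iota ltnS.
by apply: ho; rewrite /= mem_index_iota ltnS.
Qed.

Lemma measurable_history_event s : measurable (history_event s).
Proof.
apply: measurableI; apply: fin_bigcap_measurable; try exact: finite_seq.
  by move=> i /=; rewrite mem_index_iota => /andP[i1 _]; apply: measurable_outcome_event.
by move=> i _; apply: measurable_gate_event.
Qed.

Lemma prob_gate n c u : (1 <= n)%N -> 0 < c < 1 ->
  P (U n @^-1` gate c u) = (if u then c else 1 - c)%:E.
Proof.
move=> n1 /andP[c0 c1].
have h : P (U n @^-1` [set y | y <= c]) = c%:E.
  have := hU n1 (measurable_gate c true); rewrite /= uniform_prob_le//.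
  by rewrite !ltW.
case: u => //=; rewrite -preimage_setC probability_setC ?h ?EFinB//.
by apply: measurable_funPTI => //; exact: (measurable_gate c true).
Qed.

Lemma prob_outcome n l : (1 <= n)%N ->
  P (outcome n l) = (let q := if l.1 then pA else pB in if l.2 then q else 1 - q)%:E.
Proof.
move=> n1; rewrite /outcome; case: l => -[] [] /=; rewrite ?hA ?hB//.
  by rewrite probability_setC ?hA ?EFinB//; exact: mA.
by rewrite probability_setC ?hB ?EFinB//; exact: mB.
Qed.

Lemma prod_gate_event s :
  (\prod_(i <- index_iota 1 (size s).+1) P (gate_event s i))%E = (gate_weight s)%:E.
Proof.
elim: s => [|l s IH]; first by rewrite big_geq.
rewrite big_nat_recr//= eqxx prob_gate ?(arm_state01 par)// EFinM muleC.
congr (_ * _)%E; rewrite -IH; apply: congr_big_nat => // i /andP[_ /andP[_ h]].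
by rewrite (ltn_eqF h).
Qed.

Lemma prod_outcome_event s :
  (\prod_(i <- index_iota 1 (size s).+1) P (outcome_event s i))%E = (outcome_weight s)%:E.
Proof.
elim: s => [|l s IH]; first by rewrite big_geq.
rewrite big_nat_recr//= eqxx prob_outcome// EFinM muleC.
congr (_ * _)%E; rewrite -IH; apply: congr_big_nat => // i /andP[_ /andP[_ h]].
by rewrite (ltn_eqF h).
Qed.

(** The independence of (A, B) and U, then the independence in time inside each
    family. *)
Lemma prob_history_event s :
  P (history_event s) = (outcome_weight s * gate_weight s)%:E.
Proof.
rewrite /history_event hABU.
- rewrite hABind ?hUind ?iota_uniq//.
  + by rewrite EFinM -prod_gate_event -prod_outcome_event.
  + move=> i; rewrite mem_index_iota => /andP[i1 _]; split=> //.
    exact: gate_event_sigma.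
  + move=> i; rewrite mem_index_iota => /andP[i1 _]; split=> //.
    exact: outcome_event_sigma.
- apply: sigma_family_bigcap => i; rewrite mem_index_iota => /andP[i1 _].
  by split=> //; exact: outcome_event_sigma.
- apply: sigma_family_bigcap => i; rewrite mem_index_iota => /andP[i1 _].
  by split=> //; exact: gate_event_sigma.
Qed.

Fixpoint histories n : seq (seq letter) :=
  if n is m.+1 then
    [seq l :: s | s <- histories m, l <- [:: (true, true); (true, false);
                                             (false, true); (false, false)]]
  else [:: [::]].

Lemma mem_histories n s : (s \in histories n) = (size s == n).
Proof.
elim: n s => [|n IH] s; first by rewrite inE -size_eq0.
apply/(@allpairsP _ _ _ (fun s l => l :: s))/idP => /=.
  by move=> [[t l] /= []]; rewrite IH => /eqP <- _ ->.
case: s => // l s; rewrite eqSS -IH => hs; exists (s, l); split=> //.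
by case: l => -[] [].
Qed.

Lemma uniq_histories n : uniq (histories n).
Proof.
elim: n => // n IH; apply: (@allpairs_uniq _ _ _ (fun s l => l :: s)) => //.
by move=> [s l] [s' l'] /= _ _ [-> ->].
Qed.

Lemma hist_meanE n f :
  E n f = \sum_(s <- histories n) f s * (outcome_weight s * gate_weight s).
Proof.
elim: n f => [|n IH] f; first by rewrite big_seq1 /= !mulr1.
rewrite [LHS]IH (@big_allpairs_dep _ _ _ _ _ _ (fun (s : seq letter) (l : letter) => l :: s)).
apply: eq_bigr => s _.
rewrite !big_cons big_nil /step_mean /=; ring.
Qed.

Lemma history_indic n (f : seq letter -> R) w :
  f (history n w) = \sum_(s <- histories n) f s * \1_(history_event s) w.
Proof.
have hin : history n w \in histories n by rewrite mem_histories size_history.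
rewrite (bigD1_seq _ hin (uniq_histories n))/= big1_seq ?addr0.
  rewrite -history_eventE size_history indicE mem_set ?mulr1//.
move=> s /andP[sn]; rewrite mem_histories => /eqP ss.
rewrite -history_eventE ss indicE memNset ?mulr0//= => h.
by rewrite h eqxx in sn.
Qed.

Lemma measurable_history n (f : seq letter -> R) :
  measurable_fun setT (fun w => f (history n w)).
Proof.
have -> : (fun w => f (history n w)) =
    (fun w => \sum_(s <- histories n) f s * \1_(history_event s) w).
  by apply/funext => w; exact: history_indic.
apply: measurable_sum => s; apply: measurable_funM => //.
by apply: measurable_indic; exact: measurable_history_event.
Qed.

(** All integrals over the probability space that concern finitely many steps are
    computed on the tree. *)
Lemma integral_history n (f : seq letter -> R) : (forall s, 0 <= f s) ->
  (\int[P]_w (f (history n w))%:E)%E = (E n f)%:E.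
Proof.
move=> f0.
under eq_integral do rewrite history_indic -sumEFin.
rewrite ge0_integral_sum//=; last 2 first.
- move=> s; apply/measurable_EFinP; apply: measurable_funM => //.
  by apply: measurable_indic; exact: measurable_history_event.
- by move=> s w _; rewrite lee_fin mulr_ge0// indicE.
rewrite hist_meanE -sumEFin; apply: eq_bigr => s _.
under eq_integral do rewrite EFinM.
rewrite ge0_integralZl//=; last 2 first.
- apply/measurable_EFinP.
  by apply: measurable_indic; exact: measurable_history_event.
- by rewrite lee_fin.
have mh := measurable_history_event s.
rewrite integral_indic// setIT EFinM; congr (_ * _)%E.
exact: prob_history_event.
Qed.

(** * Almost sure limits *)

Lemma fatou_history (f : seq letter -> R) (c : R) :
  (forall s, 0 <= f s) -> (forall n, E n f <= c) ->
  (\int[P]_w limn_einf (fun n => (f (history n w))%:E) <= c%:E)%E.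
Proof.
move=> f0 fc.
have h := @fatou _ T R P setT measurableT (fun n w => (f (history n w))%:E).
apply: le_trans (h _ _) _.
- by move=> n; apply/measurable_EFinP; exact: measurable_history.
- by move=> n w _; rewrite lee_fin.
- by apply: limn_einf_le => n; rewrite integral_history// lee_fin.
Qed.

Lemma measurable_limn_einf_history (f : seq letter -> R) :
  measurable_fun setT (fun w => limn_einf (fun n => (f (history n w))%:E)).
Proof.
rewrite /limn_einf; apply: measurableT_comp => //.
apply: measurable_fun_limn_esup => n.
apply: measurableT_comp => //; apply/measurable_EFinP; exact: measurable_history.
Qed.

(** Fatou's lemma and Markov's inequality in one: an event on which nonnegative
    functionals of mean at most [c] tend to 1 has probability at most [c]. *)
Lemma prob_limn_einf_ge1 (f : seq letter -> R) (c : R) :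
  (forall s, 0 <= f s) -> (forall n, E n f <= c) ->
  (P [set w | (1 <= limn_einf (fun n => (f (history n w))%:E))%E] <= c%:E)%E.
Proof.
move=> f0 fc; apply: le_trans (fatou_history f0 fc).
set D := fun w => limn_einf _.
have D0 w : (0 <= D w)%E by apply: limn_einf_ge0 => n; rewrite lee_fin.
have mD : measurable_fun setT D := measurable_limn_einf_history f.
have mS : measurable [set w | (1 <= D w)%E].
  rewrite -[X in measurable X]setTI.
  exact: (emeasurable_fun_c_infty measurableT mD 1%E).
rewrite -[[set w | _]]setIT -integral_indic//.
apply: ge0_le_integral => //.
  by apply/measurable_EFinP; apply: measurable_indic.
move=> w _; rewrite indicE; case: (boolP (w \in _)) => [/set_mem//|_].
exact: D0.
Qed.

Lemma Lnorm2_history (M : R) :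
  (forall n, E n (fun s => Y s ^+ 2) <= M) ->
  forall n, ('N[P]_2%:E [EFin \o (fun w => Y (history n w))] <= (M `^ 2^-1)%:E)%E.
Proof.
move=> hM n; rewrite Lnorm.unlock.
have -> : (\int[P]_w `|(EFin \o (fun w => Y (history n w))) w| `^ 2 =
   (E n (fun s => Y s ^+ 2))%:E)%E.
  rewrite -integral_history; last by move=> s; exact: sqr_ge0.
  apply: eq_integral => w _ /=; rewrite (powR_mulrn 2)// ger0_norm//.
  exact: ltW (hist_Y_gt0 par _).
have E0 : 0 <= E n (fun s => Y s ^+ 2).
  rewrite -(hist_mean_cst par n 0); apply: (hist_mean_le par) => s _.
  exact: sqr_ge0.
rewrite poweR_EFin lee_fin ge0_ler_powR ?nnegrE//.
exact: le_trans E0 (hM n).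
Qed.

Section Limits.
Variables (Xoo Yoo : {RV P >-> R}).
Hypotheses
  (hXoo : {ae P, forall w, X (history n w) @[n --> \oo] --> Xoo w})
  (hYoo : {ae P, forall w, Y (history n w) @[n --> \oo] --> Yoo w}).

(** Uniform integrability of X_n Y_n, in the form of Fatou's lemma applied to
    (X_n Y_n - b)^2. *)
Lemma expectation_XY_gt0 (M c : R) :
  0 < c -> (forall n, E n (fun s => Y s ^+ 2) <= M) ->
  (forall n, c <= E n (fun s => X s * Y s)) ->
  (0 < 'E_P[(Xoo : T -> R) \* (Yoo : T -> R)])%E.
Proof.
move=> c0 hM hc.
rewrite expectation.unlock.
pose Z w := (Xoo w * Yoo w)%:E.
have mZ : measurable_fun setT Z.
  by apply/measurable_EFinP; apply: measurable_funM.
have hZ : {ae P, forall w, X (history n w) * Y (history n w) @[n --> \oo] --> Xoo w * Yoo w}.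
  by apply: filterS2 hXoo hYoo => w hx hy; apply: cvgM.
have Z0 : {ae P, forall w, Z w = `|Z w|%E}.
  apply: filterS hZ => w hw; rewrite gee0_abs// lee_fin.
  apply: cvgr_to_ge hw _; apply: nearW => n.
  have /andP[/ltW X0 _] := arm_state01 par (history n w).
  exact: mulr_ge0 X0 (ltW (hist_Y_gt0 par _)).
have -> : (\int[P]_w (((Xoo : T -> R) \* (Yoo : T -> R)) w)%:E = \int[P]_w `|Z w|)%E.
  apply: ae_eq_integral => //.
  - exact: measurableT_comp.
  - by apply: filterS Z0 => w hw _.
rewrite lt_neqAle integral_ge0 ?andbT//.
apply/negP => /eqP/esym /(ae_eq_integral_abs P measurableT mZ) Zae.
have M0 : 0 < M.
  have := hM 0%N; have /= := hist_Y_gt0 par [::]; nra.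
pose b := M / c.
have b0 : 0 < b by rewrite divr_gt0.
pose f s := (X s * Y s - b) ^+ 2.
have f0 s : 0 <= f s by exact: sqr_ge0.
have fE n : E n f <= M - 2 * b * c + b ^+ 2.
  apply: le_trans (_ : E n (fun s => 1 * Y s ^+ 2 + 1 * (- (2 * b) * (X s * Y s) + 1 * (b ^+ 2))) <= _).
    apply: (hist_mean_le par) => s _; rewrite /f.
    have /andP[X0 X1] := arm_state01 par s.
    have Y0 := hist_Y_gt0 par s.
    have : (X s * Y s) ^+ 2 <= Y s ^+ 2.
      rewrite lerXn2r ?nnegrE ?ler_piMl ?ltW//.
      exact: mulr_gt0.
    rewrite sqrrB; lra.
  rewrite (hist_mean_lin par) (hist_mean_lin par n _ _ (fun s => X s * Y s) (cst (b ^+ 2))).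
  rewrite (hist_mean_cst par).
  have := hM n; have : 2 * b * c <= 2 * b * E n (fun s => X s * Y s).
    by rewrite ler_wpM2l// mulr_ge0// ltW.
  lra.
have := fatou_history f0 fE.
rewrite (@ge0_ae_eq_integral _ T R P setT _ (cst (b ^+ 2)%:E))//; last first.
- have : {ae P, forall w, Xoo w * Yoo w = 0}.
    by apply: filterS Zae => w /(_ I) [].
  apply: filterS2 hZ => w hw zw _ /=.
  rewrite (@limn_einf_cvg _ (fun n => f (history n w)) (b ^+ 2))//.
  have -> : b ^+ 2 = (Xoo w * Yoo w - b) * (Xoo w * Yoo w - b).
    by rewrite zw sub0r mulrNN -expr2.
  rewrite /f; under eq_fun do rewrite expr2.
  by apply: cvgM; apply: cvgB => //; apply: cvg_cst.
- by move=> w _; rewrite lee_fin sqr_ge0.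
- by move=> w _; apply: limn_einf_ge0 => n; rewrite lee_fin.
- exact: measurable_limn_einf_history.
rewrite integral_cst//= probability_setT mule1 lee_fin.
have -> : M - 2 * b * c + b ^+ 2 = b ^+ 2 - M.
  by rewrite /b; field; exact: lt0r_neq0.
lra.
Qed.

(** For each [K], the event that Y_n exceeds K rho_n at some time and tends to 0
    lies in an event of probability at most C / K; the exceptional set is the
    intersection over [K]. *)
Lemma limn_esup_ratio (B' : R) (rho : nat -> R) :
  (forall n, sqr_gain_sum gamma n <= B') -> (forall n, 0 <= rho n) ->
  (forall n, rho n = critical_term pA pB gamma n.+1 + rho n.+1) ->
  {ae P, forall w, Yoo w = 0 ->
    (limn_esup (fun n => (Y (history n w) / rho n)%:E) < +oo)%E}.
Proof.
move=> hB' rho0 rhoS.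
have rho_gt0 n : 0 < rho n by rewrite rhoS ltr_pwDl// (critical_term_gt0 par).
pose C := var_const pA pB B'; have C0 : 0 <= C := var_const_ge0 pA pB B'.
pose dev (K : R) := passage_dev pA pB gamma x rho K.
have dev0 K s : 0 <= dev K s.
  by rewrite /dev /passage_dev; case: ifP => // _; exact: sqr_ge0.
(* The levels are K + 1, to be positive. *)
pose S (K : nat) := [set w | (1 <= limn_einf (fun n => (dev K.+1%:R (history n w))%:E))%E].
have PS K : (P (S K) <= (C / K.+1%:R)%:E)%E.
  apply: prob_limn_einf_ge1 => // n.
  exact: (hist_mean_passage_dev par hB').
have mS K : measurable (S K).
  rewrite -[X in measurable X]setTI.
  exact: (emeasurable_fun_c_infty measurableT (measurable_limn_einf_history _) 1%E).
have PN : P (\bigcap_K S K) = 0.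
  have mN : measurable (\bigcap_K S K) by exact: bigcap_measurableType.
  apply/eqP; rewrite eq_le measure_ge0 andbT leNgt; apply/negP => N0.
  have fN : P (\bigcap_K S K) \is a fin_num by exact: fin_num_measure.
  set r := fine (P (\bigcap_K S K)).
  have r0 : 0 < r by rewrite fine_gt0// N0 -ge0_fin_numE.
  have rK K : r <= C / K.+1%:R.
    rewrite -lee_fin fineK//; apply: le_trans (PS K).
    by apply: le_measure; rewrite ?inE//; exact: bigcap_inf.
  have /archi_boundP := divr_ge0 C0 (ltW r0).
  set K := Num.bound _; rewrite ltr_pdivrMr// => hK.
  have := rK K; rewrite ler_pdivlMr// => hK'.
  have : K%:R * r <= r * K.+1%:R by rewrite mulrC ler_pM2l// ler_nat.
  by move=> /(lt_le_trans hK) /lt_le_trans/(_ hK'); rewrite ltxx.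
have aeN : {ae P, forall w, ~ (\bigcap_K S K) w}.
  exists (\bigcap_K S K); split=> //; first exact: bigcap_measurableType.
  by move=> w /contrapT.
apply: filterS2 aeN hYoo => w wN hY Y0.
apply: contrapT => hlim; apply: wN => K _.
have pv_keep s l : passage_value pA pB gamma x rho K.+1%:R s != 0 ->
    passage_value pA pB gamma x rho K.+1%:R (l :: s) =
    passage_value pA pB gamma x rho K.+1%:R s.
  by move=> h /=; rewrite (negbTE h).
have [m hm] : exists m, passage_value pA pB gamma x rho K.+1%:R (history m w) != 0.
  apply: contrapT => hno; apply: hlim.
  apply: le_lt_trans (_ : (K.+1%:R%:E < +oo)%E); last exact: ltry.
  apply: limn_esup_le => n; rewrite lee_fin ler_pdivrMr// leNgt.
  apply/negP => hn; apply: hno; exists n.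
  move: hn; rewrite -[in rho n](size_history n w).
  case: (history n w) => [|l s] /= => ->.
    exact: lt0r_neq0 (hist_Y_gt0 par _).
  by case: ifPn => // _; exact: lt0r_neq0 (hist_Y_gt0 par _).
set b := passage_value _ _ _ _ _ _ _ in hm.
have pvb n : passage_value pA pB gamma x rho K.+1%:R (history (n + m) w) = b.
  by elim: n => // n IH; rewrite addSn pv_keep ?IH.
rewrite /S /= (@limn_einf_cvg _ (fun n => dev K.+1%:R (history n w)) 1)//.
rewrite -(cvg_shiftn m).
have -> : (fun n => dev K.+1%:R (history (n + m) w)) =
    (fun n => (Y (history (n + m) w) / b - 1) * (Y (history (n + m) w) / b - 1)).
  by apply/funext => n; rewrite /dev /passage_dev pvb (negbTE hm) expr2.
have hYm : Y (history (n + m) w) @[n --> \oo] --> (0 : R).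
  by have := hY; rewrite -(cvg_shiftn m) Y0.
have hdev : Y (history (n + m) w) / b - 1 @[n --> \oo] --> 0 / b - 1.
  by apply: cvgB; [apply: cvgM => //; exact: cvg_cst | exact: cvg_cst].
by have := cvgM hdev hdev; rewrite mul0r sub0r mulrNN mulr1; apply.
Qed.

(** The increments of Y are at most 2 gamma / ((1 - p) theta), hence bounded by
    the hypothesis on gamma_n exp (p Gamma_n); so the gains of 1 / (1 + Y) have a
    finite sum almost surely. *)
Lemma limit_one_imp_Y_zero (M : R) :
  (forall n, (1 <= n)%N -> gamma n * expR (p * Gam gamma n) <= M) ->
  (\sum_(1 <= n <oo) (critical_term pA pB gamma n)%:E = +oo)%E ->
  {ae P, forall w, Xoo w = 1 -> Yoo w = 0}.
Proof.
move=> hM hinf.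
have /andP[p0 p1] := gap01 par.
have hB' n : sqr_gain_sum gamma n <= M / p by exact: (sqr_gain_sum_bounded par).
set C1 := expR (M / p / (1 - p)).
have M0 : 0 <= M.
  apply: le_trans (hM 1%N isT); rewrite mulr_ge0 ?expR_ge0//.
  by have /andP[/ltW] := gam01 par 0.
(* Bounds the increments of Y. *)
pose c := 2 / (1 - p) * (C1 * M).
have q0 : 0 < 1 - p by lra.
have c0 : 0 <= c by rewrite mulr_ge0 ?divr_ge0 ?mulr_ge0 ?expR_ge0// ltW.
have hc s : 2 * gamma (size s).+1 / ((1 - p) * th s) <= c.
  have -> : 2 * gamma (size s).+1 / ((1 - p) * th s) =
     2 / (1 - p) * (gamma (size s).+1 * (th s)^-1).
    by field; rewrite !lt0r_neq0// (hist_theta_gt0 par).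
  rewrite ler_wpM2l ?divr_ge0 ?(ltW q0)//.
  have /andP[/ltW g0 _] := gam01 par (size s).
  apply: le_trans (_ : gamma (size s).+1 * (C1 * expR (p * Gam gamma (size s).+1)) <= _).
    rewrite ler_wpM2l//; apply: le_trans (inv_theta_le_expR par hB' s) _.
    by rewrite ler_wpM2l ?expR_ge0// ler_expR ler_wpM2l ?(ltW p0)// GamS lerDl.
  by rewrite mulrCA ler_wpM2l ?expR_ge0// hM.
pose g := inverse_gain pA pB gamma x c.
have g0 s : 0 <= g s by exact: (inverse_gain_ge0 par).
have mg k : measurable_fun setT (fun w => (g (history k w))%:E).
  by apply/measurable_EFinP; exact: measurable_history.
have Ig : (\int[P]_w (\sum_(0 <= k <oo) (g (history k w))%:E) <= 1)%E.
  rewrite (@integral_nneseries _ T R P setT measurableT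
    (fun k w => (g (history k w))%:E))//; last by move=> *; rewrite lee_fin.
  under eq_eseriesr do rewrite integral_history//.
  apply: lime_le; first by apply: is_cvg_nneseries => k _ _;
    rewrite -integral_history// integral_ge0// => w _; rewrite lee_fin.
  apply: nearW => n; rewrite sumEFin lee_fin.
  exact: (hist_mean_inverse_gain_sum par).
have finG : {ae P, forall w, (\sum_(0 <= k <oo) (g (history k w))%:E)%E \is a fin_num}.
  have G0 w : (0 <= \sum_(0 <= k <oo) (g (history k w))%:E)%E.
    by apply: nneseries_ge0 => *; rewrite lee_fin.
  have : P.-integrable setT (fun w => \sum_(0 <= k <oo) (g (history k w))%:E)%E.
    apply/integrableP; split.
      by apply: ge0_emeasurable_sum => // *; rewrite lee_fin.
    under eq_integral do rewrite gee0_abs//.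
    by apply: le_lt_trans Ig _; rewrite ltry.
  by move/(integrable_ae measurableT); apply: filterS => w /(_ I).
apply: filterS3 finG hXoo hYoo => w fw hX hY X1.
have Y0 : 0 <= Yoo w.
  by apply: cvgr_to_ge hY _; apply: nearW => n; exact: ltW (hist_Y_gt0 par _).
apply/eqP; rewrite eq_le Y0 andbT leNgt; apply/negP => y0.
set y := Yoo w in hY y0.
have [N _ hN] : \forall n \near \oo, [/\ 1 / 2 <= X (history n w),
     y / 2 <= Y (history n w) & Y (history n w) <= 2 * y].
  have hx : \forall n \near \oo, 1 / 2 <= X (history n w).
    by apply: (cvgr_ge (Xoo w) hX); rewrite X1; lra.
  have hy1 : \forall n \near \oo, y / 2 <= Y (history n w).
    by apply: (cvgr_ge y hY); lra.
  have hy2 : \forall n \near \oo, Y (history n w) <= 2 * y.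
    by apply: (cvgr_le y hY); lra.
  by apply: filterS3 hx hy1 hy2 => n; split.
have [D D0 hD] := @inverse_gain_critical_term R pA pB gamma x par c (history ^~ w) y N c0 y0
  (fun k => ex_intro _ _ erefl) (fun k => size_history k w) (fun k kN => hN k kN).
apply: (@nneseries_unbounded R (critical_term pA pB gamma) N
  (fine (\sum_(0 <= k <oo) (g (history k w))%:E)%E / D) _ hinf).
  by move=> n; exact: critical_term_ge0.
move=> n; rewrite ler_pdivlMr// mulr_suml.
apply: le_trans (_ : \sum_(N <= k < n) g (history k w) <= _).
  rewrite big_nat_cond [leRHS]big_nat_cond; apply: ler_sum => k /andP[/andP[Nk _] _].
  by rewrite mulrC hD.
rewrite -lee_fin -sumEFin fineK//.
have [nN|Nn] := leqP n N.
  by rewrite big_geq// nneseries_ge0// => *; rewrite lee_fin.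
apply: le_trans (_ : (\sum_(0 <= k < n) (g (history k w))%:E <= _)%E).
  rewrite [leRHS](@big_cat_nat _ _ _ N)//=; last exact: ltnW.
  by rewrite leeDr// sume_ge0// => *; rewrite lee_fin.
by apply: nneseries_lim_ge => *; rewrite lee_fin.
Qed.

(** 0 <= 1 - X_n <= Y_n because theta_n <= 1. *)
Lemma Y_zero_imp_limit_one : {ae P, forall w, Yoo w = 0 -> Xoo w = 1}.
Proof.
apply: filterS2 hXoo hYoo => w hX hY Y0.
have h : 1 - X (history n w) @[n --> \oo] --> 1 - Xoo w.
  by apply: cvgB => //; exact: cvg_cst.
have h1 : 1 - Xoo w <= Yoo w.
  rewrite -subr_ge0; apply: cvgr_to_ge (cvgB hY h) _; apply: nearW => n.
  rewrite subr_ge0 /hist_Y ler_pdivlMr ?(hist_theta_gt0 par)//.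
  have /andP[_ X1] := arm_state01 par (history n w).
  by rewrite ler_piMr ?(hist_theta_le1 par)//; lra.
have h2 : 0 <= 1 - Xoo w.
  apply: cvgr_to_ge h _; apply: nearW => n.
  have /andP[_ X1] := arm_state01 par (history n w); lra.
by move: h1; rewrite Y0 => h1; apply/eqP; rewrite eq_le; apply/andP; split; lra.
Qed.

End Limits.


End ObservedHistory.


Theorem proposition5 (R : realType) (d : measure_display)
  (T : measurableType d) (P : probability T R)
  (pA pB : R) (hpB : 0 < pB) (hpBA : pB < pA) (hpA : pA < 1)
  (gamma : nat -> R)
  (hgamma : forall n, (1 <= n)%N -> 0 < gamma n < 1)
  (hGam : Gam gamma n @[n --> \oo] --> +oo)
  (U : nat -> {RV P >-> R}) (A B : nat -> set T)
  (hU : forall n, (1 <= n)%N -> forall S : set R, measurable S ->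
    distribution P (U n) S = uniform_prob (@ltr01 R) S)
  (hUind : mutually_independent P ge1 (fun n => sigma_rv (U n)))
  (mA : forall n, (1 <= n)%N -> measurable (A n))
  (mB : forall n, (1 <= n)%N -> measurable (B n))
  (hA : forall n, (1 <= n)%N -> P (A n) = pA%:E)
  (hB : forall n, (1 <= n)%N -> P (B n) = pB%:E)
  (hABind : mutually_independent P ge1
    (fun n => sigma_rv (indic_pair R (A n) (B n))))
  (hABU : independent_systems P
    (sigma_family ge1 (fun n => sigma_rv (indic_pair R (A n) (B n))))
    (sigma_family ge1 (fun n => sigma_rv (U n))))
  (x : R) (hx : 0 < x < 1) :
  let X := bandit gamma U A B x in
  let Y := Ymart (pA - pB) gamma X in
  let a := fun n => gamma n ^+ 2 * expR ((pA - pB) * Gam gamma n) in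
  forall (Xoo Yoo : {RV P >-> R})
    (hXoo : {ae P, forall w, X n w @[n --> \oo] --> Xoo w})
    (hYoo : {ae P, forall w, Y n w @[n --> \oo] --> Yoo w}),
  ((\sum_(1 <= n <oo) (a n)%:E < +oo)%E ->
    [/\ (ereal_sup (range (fun n => 'N[P]_2%:E [EFin \o Y n])) < +oo)%E,
        (0 < 'E_P[(Xoo : T -> R) \* (Yoo : T -> R)])%E
      & {ae P, forall w, Yoo w = 0 ->
          (limn_esup (fun n =>
             (Y n w / fine (\sum_(n <= k <oo) (a k.+1)%:E)%E)%:E) < +oo)%E}])
  /\
  ((\sum_(1 <= n <oo) (a n)%:E = +oo)%E ->
    has_ubound [set gamma n * expR ((pA - pB) * Gam gamma n) | n in ge1] ->
    {ae P, forall w, Xoo w = 1 <-> Yoo w = 0}).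
Proof.
move=> X Y a Xoo Yoo hXoo hYoo.
have par := BanditParameters hpB hpBA hpA hgamma hx.
pose h := history gamma x U A B.
have XE : X = fun n w => arm_state gamma x (h n w).
  by apply/funext => n; apply/funext => w; exact: bandit_history.
have YE : Y = fun n w => hist_Y pA pB gamma x (h n w).
  by apply/funext => n; apply/funext => w; exact: Ymart_history.
rewrite XE in hXoo; rewrite YE in hYoo *.
split=> [afin|ainf [M hM]].
- have a0 n : 0 <= a n by exact: critical_term_ge0.
  have asum := partial_sum_le_fine a0 afin.
  set S := fine _ in asum.
  have g2 n : sqr_gain_sum gamma n <= S.
    exact: le_trans (sqr_gain_sum_le_critical par n) (asum n).
  have C0 : 0 <= var_const pA pB S by exact: var_const_ge0.
  have L2 n : hist_mean pA pB gamma x n (fun s => hist_Y pA pB gamma x s ^+ 2) <=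
      1 + var_const pA pB S * S.
    apply: le_trans (hist_mean_sqr_le par g2 n) _.
    by rewrite lerD2l ler_wpM2l// asum.
  split.
  + apply: le_lt_trans (ltry ((1 + var_const pA pB S * S) `^ 2^-1)).
    apply: ge_ereal_sup => _ [n _ <-].
    exact: (Lnorm2_history par hU hUind mA mB hA hB hABind hABU L2 n).
  + apply: (expectation_XY_gt0 par hU hUind mA mB hA hB hABind hABU hXoo hYoo
      (c := x * (1 - x) * expR (- (pB / (1 - pA)) * S)) _ L2).
      by case/andP: hx => x0 x1; rewrite !mulr_gt0 ?expR_gt0// subr_gt0.
    move=> n; apply: le_trans (hist_mean_XY_ge par n).
    have /andP[x0 x1] := hx.
    rewrite ler_wpM2l ?mulr_ge0 ?subr_ge0 ?(ltW x0) ?(ltW x1)// ler_expR !mulNr lerN2.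
    by rewrite ler_wpM2l// divr_ge0 ?subr_ge0 ?(ltW hpA) ?(ltW hpB).
  + exact: (limn_esup_ratio par hU hUind mA mB hA hB hABind hABU hYoo g2
      (tail_sum_ge0 a0) (tail_sumS a0 afin)).
- have hM' n : (1 <= n)%N -> gamma n * expR ((pA - pB) * Gam gamma n) <= M.
    by move=> n1; apply: hM; exists n.
  have h1 := limit_one_imp_Y_zero par hU hUind mA mB hA hB hABind hABU hXoo hYoo hM' ainf.
  have h2 := Y_zero_imp_limit_one par hXoo hYoo.
  by apply: filterS2 h1 h2 => w ? ?; split.
Qed.
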